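(* Let $\Theta=\{\theta\in\mathbb{R}^p:\|\theta\|_0\le k\}$ with $k<p/2$, and for $\theta^*\in\Theta$ let $P_{\theta^*}=\mathcal{N}(\theta^*,I_p)$; consider data $X_1,\dots,X_n\stackrel{i.i.d.}{\sim}P$ where $W(P,P_{\theta^*})\le\epsilon$. There exist constants $C,c>0$ such that $$\inf_{\widehat\theta}\sup_{\theta^*\in\Theta,\;P:W(P_{\theta^*},P)\le\epsilon}\mathbb{P}\left(\|\theta^*-\widehat\theta\|_2\ge C\left(\sqrt{\frac{k\log\frac pk}{n}}\vee\epsilon\right)\right)\ge c,$$ the infimum being over all estimators based on $X_1,\dots,X_n$.
   Context: $W$ is the Wasserstein-1 distance $W(P,Q)=\inf_\Pi\mathbb{E}_\Pi\|X-Y\|_2$ over couplings. $a\vee b=\max(a,b)$. *)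

(* Defs.v *)
From HB Require Import structures.
From mathcomp Require Import all_boot all_order all_algebra.
From mathcomp Require Import all_classical all_reals all_analysis.
Set Implicit Arguments. Unset Strict Implicit. Unset Printing Implicit Defensive.
Import Order.TTheory GRing.Theory Num.Theory.
Import numFieldNormedType.Exports.
Local Open Scope classical_set_scope.
Local Open Scope ring_scope.

(* R^p is represented by p.-tuple R, with the product (coordinate) sigma-algebra
   that mathcomp-analysis puts on tuples (= Borel sigma-algebra of R^p). *)

Definition dist2 {R : realType} {p : nat} (x y : p.-tuple R) : R :=
  Num.sqrt (\sum_(i < p) (tnth x i - tnth y i) ^+ 2).

Definition l0norm {R : realType} {p : nat} (x : p.-tuple R) : nat :=
  #|[set i : 'I_p | tnth x i != 0]|.

(* Q is the product measure P_0 (x) ... (x) P_{n-1} on n.-tuple T: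
   it agrees with the product on every measurable rectangle (this
   determines Q uniquely, rectangles being a generating pi-system). *)
Definition is_product_measure {d} {T : measurableType d} {R : realType} {n : nat}
  (P : 'I_n -> probability T R)
  (Q : probability (n.-tuple T) R) : Prop :=
  forall A : 'I_n -> set T, (forall i, measurable (A i)) ->
    Q [set x | forall i, A i (tnth x i)] = (\prod_(i < n) P i (A i))%E.

Definition is_iid_sample_law {d} {T : measurableType d} {R : realType} {n : nat}
  (P : probability T R) (Q : probability (n.-tuple T) R) : Prop :=
  is_product_measure (fun _ => P) Q.

Definition is_std_gaussian {R : realType} {p : nat} (theta : p.-tuple R)
  (G : probability (p.-tuple R) R) : Prop :=
  forall A : 'I_p -> set R, (forall i, measurable (A i)) ->
    G [set x | forall i, A i (tnth x i)] =
      (\prod_(i < p) normal_prob (tnth theta i) 1 (A i))%E.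

Definition is_coupling {d} {T : measurableType d} {R : realType}
  (P Q : probability T R) (Pi : probability (T * T)%type R) : Prop :=
  (forall A, measurable A -> Pi (A `*` setT) = P A) /\
  (forall B, measurable B -> Pi (setT `*` B) = Q B).

Definition W1 {R : realType} {p : nat} (P Q : probability (p.-tuple R) R) : \bar R :=
  ereal_inf [set (\int[Pi]_z (dist2 z.1 z.2)%:E)%E
            | Pi in [set Pi : probability (p.-tuple R * p.-tuple R)%type R
                    | is_coupling P Q Pi]].

(* Main.v *)
Require Import Defs.
From HB Require Import structures.
From mathcomp Require Import all_boot all_order all_algebra.
From mathcomp Require Import all_classical all_reals all_analysis.
From mathcomp Require Import measurable_realfun ring lra.
Import Order.TTheory GRing.Theory Num.Theory.
Import numFieldNormedType.Exports.
Set Implicit Arguments. Unset Strict Implicit. Unset Printing Implicit Defensive.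
Local Open Scope classical_set_scope.
Local Open Scope ring_scope.

(* If eps dominates, the data law N(0, I)^n is admissible both for theta = 0
   and, since the Wasserstein distance of two translates is at most the length
   of the translation, for theta = eps e_1; no estimator is close to both.

   If sqrt (k log (p/k) / n) dominates, take P = P_theta and split k m
   coordinates, m = p %/ k, into k blocks of size m; theta has one spike of
   height tau in each block, with n tau^2 = (ln m) / 2.  Adding a spike to a
   parameter changes the sample law by a chi-square factor exp (n tau^2), so
   the Cauchy-Schwarz inequality shows that, the other spikes being fixed, a
   uniformly random spike position in a block is identified with probability at
   most exp (- (ln m) / 4).  Averaging over all positions, some theta has a
   constant expected proportion of misidentified blocks, hence with constant
   probability a constant proportion; each of them costs the estimator a
   squared error of at least tau^2 / 4. *)

(** * Gaussian measures on the line *)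

Section image_probability.
Context d1 d2 (T1 : measurableType d1) (T2 : measurableType d2) (R : realType).
Variables (P : probability T1 R) (f : T1 -> T2) (mf : measurable_fun setT f).

Definition image_prob : probability T2 R :=
  let f' : {mfun T1 >-> T2} := HB.pack f (isMeasurableFun.Build _ _ _ _ _ mf) in
  distribution P f'.

Lemma image_probE A : image_prob A = P (f @^-1` A).
Proof. by []. Qed.

Lemma ge0_integral_image_prob (g : T2 -> \bar R) :
  measurable_fun setT g -> (forall y, 0 <= g y)%E ->
  (\int[image_prob]_y g y = \int[P]_x g (f x))%E.
Proof. by move=> mg g0; rewrite ge0_integral_distribution. Qed.

End image_probability.

Section gaussian_line.
Variable R : realType.
Implicit Types (m v x : R).
Local Notation mR := (measurableTypeR R).
Local Notation mu := (@lebesgue_measure R).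

Lemma measurable_shift v : measurable_fun setT (shift v : mR -> mR).
Proof. exact: measurable_funD. Qed.

Lemma shift_preimage_itv v b1 b2 x y :
  shift v @^-1` [set` Interval (BSide b1 x) (BSide b2 y)] =
  [set` Interval (BSide b1 (x - v)) (BSide b2 (y - v))].
Proof.
apply/seteqP; split => z /=; rewrite !in_itv/=;
  by case: b1; case: b2 => /=; rewrite ?lerBlDr ?lerBrDr ?ltrBlDr ?ltrBrDr.
Qed.

(** By uniqueness of Lebesgue measure, since translating a half-open interval keeps its length. *)
Lemma lebesgue_measure_shift v (A : set mR) : measurable A ->
  pushforward mu (shift v : mR -> mR) A = mu A.
Proof.
move=> mA; apply/esym/lebesgue_measure_unique => //=.
  exact: measurable_shift.
move=> mv _ [[a b]] _ <-.
rewrite /pushforward shift_preimage_itv//=.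
have e c d : mu (`]c, d] : set R) = (if c < d then d - c else 0)%:E.
  by rewrite lebesgue_measure_itv/= lte_fin -EFinB; case: ifP.
rewrite (e a b) (e (a - v) (b - v)).
by rewrite ltrD2r; congr (if _ then _ else _)%:E; ring.
Qed.

Lemma ge0_integral_shift v (f : mR -> \bar R) (D : set mR) :
  measurable D -> measurable_fun D f -> (forall x, 0 <= f x)%E ->
  (\int[mu]_(x in D) f x = \int[mu]_(x in shift v @^-1` D) (f \o shift v) x)%E.
Proof.
move=> mD mf f0.
rewrite -[RHS](@ge0_integral_pushforward _ _ mR mR)//; last exact: measurable_shift.
apply: eq_measure_integral => //= [|? ? *]; first exact: measurable_shift.
exact/esym/lebesgue_measure_shift.
Qed.

Lemma normal_pdf1E m x :
  normal_pdf m 1 x = normal_peak 1 * expR (- ((x - m) ^+ 2 / 2)).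
Proof.
by rewrite normal_pdfE ?oner_eq0// /normal_fun expr1n mulNr.
Qed.

Lemma normal_prob_shift m v (A : set mR) : measurable A ->
  normal_prob m 1 (shift v @^-1` A) = normal_prob (m + v) 1 A.
Proof.
move=> mA; rewrite /normal_prob [RHS](ge0_integral_shift v)//.
- apply: eq_integral => x _; rewrite /= !normal_pdf1E; congr (_ * expR _)%:E; ring.
- apply/measurable_EFinP; apply: measurable_funTS; exact: measurable_normal_pdf.
- by move=> x; rewrite lee_fin normal_pdf_ge0.
Qed.

(** The Radon-Nikodym derivative of [normal_prob m 1] is almost everywhere [normal_pdf m 1], both
    having the same integral over every measurable set. *)
Lemma integral_normal_prob m (f : mR -> \bar R) :
  measurable_fun setT f -> (forall x, 0 <= f x)%E ->
  (\int[normal_prob m 1]_x f x = \int[mu]_x (f x * (normal_pdf m 1 x)%:E))%E.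
Proof.
move=> mf f0.
have dom := normal_prob_dominates m 1.
rewrite -(Radon_Nikodym_SigmaFinite.change_of_variables dom f0 measurableT mf).
have mg := Radon_Nikodym_SigmaFinite.f_integrable dom.
apply: ae_eq_integral => //.
- by apply: emeasurable_funM => //; exact: (measurable_int mu).
- apply: emeasurable_funM => //; apply/measurable_EFinP.
  exact: measurable_normal_pdf.
- apply: ae_eqe_mul2l => /=.
  apply: integral_ae_eq => //=.
    by apply/measurable_EFinP; exact: measurable_normal_pdf.
  by move=> E _ mE; rewrite -Radon_Nikodym_SigmaFinite.f_integral.
Qed.

End gaussian_line.

(** * Chi-square comparison *)

Section chi2.
Variable R : realType.
Local Open Scope ereal_scope.

(* For a probability [P'] with density [L] with respect to [P], this says
   [\int L^2 dP <= D]; the dual form needs no density and tensorizes by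
   Fubini's theorem. *)
Definition chi2_le d (T : measurableType d) (D : R) (P' P : set T -> \bar R) :=
  forall f : T -> \bar R, measurable_fun setT f -> (forall x, 0 <= f x) ->
  (\int[P']_x f x) * (\int[P']_x f x) <= D%:E * \int[P]_x (f x * f x).

(** Reduces Cauchy-Schwarz for integrals to inequalities linear in [a] and [b], which can be checked
    pointwise under the integral sign. *)
Lemma sqre_le_of_linear (a b : \bar R) (D : R) :
  (0 < D)%R -> 0 <= a -> 0 <= b ->
  (forall t : R, (0 < t)%R -> (2 * t)%:E * a <= (t * t)%:E * b + D%:E) ->
  a * a <= D%:E * b.
Proof.
move=> D0; case: b => [b| |]//; last by rewrite gt0_muley ?lte_fin// => *; exact: leey.
case: a => [a| |]//; last first.
  by move=> _ _ /(_ 1%R ltr01); rewrite gt0_muley ?lte_fin ?mulr_gt0.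
rewrite !lee_fin => a0 b0 H.
move: a0; rewrite le_eqVlt => /predU1P[<-|a0].
  by rewrite mul0r mulr_ge0// ltW.
(* The optimal [t] is [a / b]; in the equality case it is [D / a], which makes sense even when [b]
   is zero. *)
have := H (D / a)%R; rewrite divr_gt0// -!EFinM -EFinD !lee_fin => /(_ isT).
have -> : (2 * (D / a) * a = 2 * D)%R by field; rewrite gt_eqF.
rewrite -lerBlDr (_ : 2 * D - D = D)%R; last by ring.
have -> : (D / a * (D / a) * b = D * (D * b / (a * a)))%R by field; rewrite gt_eqF.
by rewrite -[X in (X <= _)%R]mulr1 ler_pM2l// ler_pdivlMr ?mulr_gt0// mul1r.
Qed.

Lemma chi2_le_indic d (T : measurableType d) (D : R)
    (P' P : {measure set T -> \bar R}) (A : set T) :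
  chi2_le D P' P -> measurable A -> P' A * P' A <= D%:E * P A.
Proof.
move=> + mA => /(_ (fun x => (\1_A x)%:E)).
have -> : (fun x => (\1_A x)%:E * (\1_A x)%:E) = (fun x => (\1_A x)%:E : \bar R).
  apply/funext => x; rewrite -EFinM indicE.
  by case: (_ \in _); rewrite ?mulr1 ?mulr0.
rewrite !integral_indic// !setIT; apply => //.
by apply/measurable_EFinP; exact: measurable_indic.
Qed.

Lemma chi2_le_fine d (T : measurableType d) (D : R) (P' P : probability T R)
    (A : set T) :
  chi2_le D P' P -> measurable A -> (fine (P' A) ^+ 2 <= D * fine (P A))%R.
Proof.
move=> H mA; rewrite -lee_fin expr2 !EFinM !fineK ?fin_num_measure//.
exact: chi2_le_indic.
Qed.

Lemma chi2_le_image d1 d2 (T1 : measurableType d1) (T2 : measurableType d2)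
    (D : R) (P' P : probability T1 R) (f : T1 -> T2)
    (mf : measurable_fun setT f) :
  chi2_le D P' P -> chi2_le D (image_prob P' mf) (image_prob P mf).
Proof.
move=> H g mg g0.
have mgg : measurable_fun setT (fun y => g y * g y) by exact: emeasurable_funM.
have gg0 y : 0 <= g y * g y by rewrite mule_ge0.
rewrite (ge0_integral_image_prob P' mf mg g0).
rewrite (ge0_integral_image_prob P mf mgg gg0).
by apply: H => //; exact: (measurableT_comp mg mf).
Qed.

(** One variable at a time: the bound on the second factor is applied to the partial integral [G],
    then the bound on the first factor inside the outer integral. *)
Lemma chi2_le_prod d1 d2 (T1 : measurableType d1) (T2 : measurableType d2)
    (D1 D2 : R) (P1' P1 : probability T1 R) (P2' P2 : probability T2 R) :
  (0 <= D1)%R -> (0 <= D2)%R -> chi2_le D1 P1' P1 -> chi2_le D2 P2' P2 ->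
  chi2_le (D1 * D2) (P1' \x P2') (P1 \x P2).
Proof.
move=> D10 D20 H1 H2 f mf f0.
have mff : measurable_fun setT (fun z => f z * f z) by exact: emeasurable_funM.
have ff0 z : 0 <= f z * f z by rewrite mule_ge0.
rewrite !fubini_tonelli2//.
set G := fubini_G P1' f.
have mG : measurable_fun setT G by exact: measurable_fun_fubini_tonelli_G.
have G0 y : 0 <= G y by apply: integral_ge0.
apply: (le_trans (H2 G mG G0)).
rewrite mulrC EFinM -muleA; apply: lee_wpmul2l; first by rewrite lee_fin.
have mH := measurable_fun_fubini_tonelli_G (m1 := P1) _ mff ff0.
rewrite -ge0_integralZl ?lee_fin//; last by move=> y _; apply: integral_ge0.
apply: ge0_le_integral => //.
- by move=> y _; rewrite mule_ge0.
- exact: emeasurable_funM.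
- exact: measurable_funeM.
- move=> y _; apply: (H1 (fun x => f (x, y))) => // .
  exact: measurableT_comp.
Qed.

Local Notation mR := (measurableTypeR R).

(** Completing the square, the squared density at [m'] divided by the density at [m] is
    [expR ((m' - m) ^+ 2)] times the normal density centred at [m + 2 * (m' - m)], so it integrates
    to the constant. *)
Lemma chi2_le_normal_prob (m' m : R) :
  chi2_le (expR ((m' - m) ^+ 2))
    (normal_prob m' 1 : set mR -> \bar R) (normal_prob m 1).
Proof.
move=> f mf f0.
have ff0 x : 0 <= f x * f x by rewrite mule_ge0.
have mff : measurable_fun setT (fun x => f x * f x) by exact: emeasurable_funM.
have mpdf r : measurable_fun setT (fun x : mR => (normal_pdf r 1 x)%:E).
  by apply/measurable_EFinP; exact: measurable_normal_pdf.
have pdf0 r x : 0 <= (normal_pdf r 1 x)%:E by rewrite lee_fin normal_pdf_ge0.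
apply: sqre_le_of_linear; [exact: expR_gt0|exact: integral_ge0|exact: integral_ge0|].
move=> t t0; rewrite !integral_normal_prob//.
(* The constant is written as an integral so that the inequality can be proved pointwise. *)
have := integral_normal_pdf (m + 2 * (m' - m))%R 1.
move/(congr1 (fun z => (expR ((m' - m) ^+ 2))%:E * z)); rewrite mule1 => <-.
rewrite -!ge0_integralZl ?lee_fin ?mulr_ge0 ?expR_ge0 ?(ltW t0)//; first last.
- by move=> x _; rewrite mule_ge0.
- exact: emeasurable_funM.
- by move=> x _; rewrite mule_ge0.
- exact: emeasurable_funM.
rewrite -ge0_integralD//; first last.
- exact: measurable_funeM.
- by move=> x _; rewrite mule_ge0// lee_fin expR_ge0.
- by apply: measurable_funeM; exact: emeasurable_funM.
- by move=> x _; rewrite !mule_ge0// lee_fin mulr_ge0 ?ltW.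
apply: ge0_le_integral => //.
- by move=> x _; rewrite !mule_ge0// lee_fin mulr_ge0 ?ltW.
- by apply: measurable_funeM; exact: emeasurable_funM.
- apply: emeasurable_funD; last exact: measurable_funeM.
  by apply: measurable_funeM; exact: emeasurable_funM.
move=> x _.
pose p := normal_pdf m 1 x; pose p' := normal_pdf m' 1 x.
pose q := (expR ((m' - m) ^+ 2) * normal_pdf (m + 2 * (m' - m)) 1 x)%R.
have peak : (0 < normal_peak 1 :> R)%R by rewrite normal_peak_gt0 ?oner_eq0.
have p0 : (0 < p)%R by rewrite /p normal_pdf1E mulr_gt0 ?expR_gt0.
have pq : (p' * p' = p * q)%R.
  rewrite /p /p' /q !normal_pdf1E.
  transitivity (normal_peak 1 ^+ 2 * (expR (- ((x - m) ^+ 2 / 2)) *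
     expR ((m' - m) ^+ 2) * expR (- ((x - (m + 2 * (m' - m))) ^+ 2 / 2))))%R;
    last by ring.
  rewrite mulrACA -expr2; congr (_ * _)%R; rewrite -!expRD; by congr expR; field.
rewrite /= -/p -/p'.
have -> : (expR ((m' - m) ^+ 2))%:E * (normal_pdf (m + 2 * (m' - m)) 1 x)%:E
    = q%:E by [].
move: (f0 x); case: (f x) => [r| |]// r0; last first.
  have -> : (t * t)%:E * (+oo * +oo * p%:E) = +oo.
    by rewrite mulyy gt0_mulye ?lte_fin// gt0_muley// lte_fin mulr_gt0.
  by rewrite addye// leey.
rewrite -!EFinM -EFinD lee_fin.
(* After multiplication by [p], the difference of the two sides is the square of
   [t * r * p - p']. *)
rewrite -(ler_pM2r p0) -subr_ge0.
have -> : ((t * t * (r * r * p) + q) * p - 2 * t * (r * p') * p =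
   (t * r * p) ^+ 2 - 2 * t * r * p * p' + p * q)%R by ring.
rewrite -pq (_ : _ + _ = (t * r * p - p') ^+ 2)%R ?sqr_ge0//; ring.
Qed.

End chi2.

(** * Product measures on tuples *)

Section tuple_product.
Context d (T : measurableType d) (R : realType).
Local Open Scope ereal_scope.

Definition cons_pair n (z : T * n.-tuple T) : n.+1.-tuple T := cons_tuple z.1 z.2.

Lemma measurable_cons_pair n : measurable_fun setT (@cons_pair n).
Proof. exact: (measurable_cons measurable_fst measurable_snd). Qed.

(** Built by iterated binary products, so that [chi2_le_prod] passes to tuples by induction. *)
Fixpoint tuple_prob n : ('I_n -> probability T R) -> probability (n.-tuple T) R :=
  match n with
  | 0 => fun=> [the probability _ _ of \d_[tuple]]
  | n.+1 => fun P =>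
      image_prob [the probability _ _ of P ord0 \x tuple_prob (P \o lift ord0)]
        (@measurable_cons_pair n)
  end.

Lemma measurable_rectangle n (A : 'I_n -> set T) :
  (forall i, measurable (A i)) ->
  measurable [set x : n.-tuple T | forall i, A i (tnth x i)].
Proof.
move=> mA.
rewrite (_ : mkset _ =
    \bigcap_(i in [set: 'I_n]) ((fun x : n.-tuple T => tnth x i) @^-1` A i)).
  apply: fin_bigcap_measurable => // i _.
  rewrite -[X in measurable X]setTI; exact: measurable_tnth.
by apply/seteqP; split => x /= Ax i; [move=> _|]; exact: Ax.
Qed.

Lemma tuple_prob_is_product n (P : 'I_n -> probability T R) :
  is_product_measure P (tuple_prob P).
Proof.
elim: n P => [P A mA|n IH P A mA].
  by rewrite /= big_ord0 diracE mem_set// => -[].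
transitivity ((P ord0 \x tuple_prob (P \o lift ord0))
    (A ord0 `*` [set x | forall i, A (lift ord0 i) (tnth x i)])).
  congr (product_measure1 _ _ _).
  apply/seteqP; split => -[x y] /=.
    move=> H; split => [|i]; first exact: (H ord0).
    by have := H (lift ord0 i); rewrite /cons_pair/= tnthS.
  move=> [H0 H] i; case: (unliftP ord0 i) => [j|] ->.
    by rewrite /cons_pair/= tnthS; exact: H.
  exact: H0.
have mrest := measurable_rectangle (fun i => mA (lift ord0 i)).
rewrite (product_measure1E _ _ (mA ord0) mrest).
by rewrite big_ord_recl; congr (_ * _); exact: (IH _ (fun i => A (lift ord0 i))).
Qed.

Lemma chi2_le_tuple n (D : 'I_n -> R) (P' P : 'I_n -> probability T R) :
  (forall i, 0 <= D i)%R -> (forall i, chi2_le (D i) (P' i) (P i)) ->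
  chi2_le (\prod_(i < n) D i)%R (tuple_prob P') (tuple_prob P).
Proof.
elim: n D P' P => [|n IH] D P' P D0 H /=.
  move=> f mf f0; rewrite big_ord0 mul1e !integral_dirac// ?diracT ?mul1e//.
  exact: emeasurable_funM.
apply: chi2_le_image; rewrite big_ord_recl; apply: chi2_le_prod => //.
- by apply: prodr_ge0.
- by apply: IH => i; [exact: D0|exact: H].
Qed.

End tuple_product.

(** * Gaussian vectors and samples, and the Wasserstein distance of translates *)

Section gaussian_tuple.
Variable R : realType.
Local Notation mR := (measurableTypeR R).

(* [normal_prob] lives on the measurable type [measurableTypeR R], the tuples
   of the statement on the canonical measurable structure of [R]; both have the
   same measurable sets but different displays. *)
Definition gauss1 (m : R) : probability R R :=
  image_prob (normal_prob m 1)
    (@measurable_id _ mR setT : measurable_fun setT (idfun : mR -> R)).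

Definition gauss p (theta : p.-tuple R) : probability (p.-tuple R) R :=
  tuple_prob (fun i => gauss1 (tnth theta i)).

Definition gauss_sample n p (theta : p.-tuple R) :
    probability (n.-tuple (p.-tuple R)) R :=
  tuple_prob (fun _ : 'I_n => gauss theta).

Lemma gaussP p (theta : p.-tuple R) : is_std_gaussian theta (gauss theta).
Proof. by move=> A mA; rewrite tuple_prob_is_product. Qed.

Lemma gauss_sampleP n p (theta : p.-tuple R) :
  is_iid_sample_law (gauss theta) (gauss_sample n theta).
Proof. exact: tuple_prob_is_product. Qed.

(** [chi2_le_tuple] is applied twice, over the observations and over the coordinates; the exponents
    add up. *)
Lemma chi2_le_gauss_sample n p (theta' theta : p.-tuple R) :
  chi2_le (expR ((\sum_(i < p) (tnth theta' i - tnth theta i) ^+ 2) *+ n))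
    (gauss_sample n theta') (gauss_sample n theta).
Proof.
have -> : expR ((\sum_(i < p) (tnth theta' i - tnth theta i) ^+ 2) *+ n) =
  \prod_(j < n) \prod_(i < p) expR ((tnth theta' i - tnth theta i) ^+ 2).
  by rewrite prodr_const card_ord -expR_sum -expRM_natl mulr_natl.
apply: chi2_le_tuple => [j|j].
  by apply: prodr_ge0 => i _; exact: expR_ge0.
apply: chi2_le_tuple => [i|i]; first exact: expR_ge0.
apply: chi2_le_image; exact: chi2_le_normal_prob.
Qed.

Definition shift_tuple p (v x : p.-tuple R) : p.-tuple R :=
  [tuple tnth x i + tnth v i | i < p].

Lemma measurable_shift_tuple p (v : p.-tuple R) :
  measurable_fun setT (shift_tuple v).
Proof.
apply/measurable_fun_tnthP => i.
rewrite (_ : _ \o _ = fun x : p.-tuple R => tnth x i + tnth v i).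
  by apply: measurable_funD => //; exact: measurable_tnth.
by apply/funext => x; rewrite /= tnth_mktuple.
Qed.

Lemma gauss_shiftP p (theta v theta' : p.-tuple R) :
  theta' = shift_tuple v theta ->
  is_std_gaussian theta' (image_prob (gauss theta) (measurable_shift_tuple v)).
Proof.
move=> -> A mA; rewrite image_probE.
have mB i : measurable (shift (tnth v i) @^-1` A i : set R).
  by rewrite -[X in measurable X]setTI; exact: (measurable_shift _ _ (mA i)).
transitivity (gauss theta
    [set x | forall i, (shift (tnth v i) @^-1` A i : set R) (tnth x i)]).
  by congr (gauss theta _); apply/seteqP; split => x /= H i;
    have := H i; rewrite tnth_mktuple.
rewrite (gaussP theta mB); apply: eq_bigr => i _.
by rewrite tnth_mktuple; exact: (normal_prob_shift _ _ (mA i)).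
Qed.

Lemma measurable_dist2 p d (T : measurableType d) (f g : T -> p.-tuple R) :
  measurable_fun setT f -> measurable_fun setT g ->
  measurable_fun setT (fun x => dist2 (f x) (g x)).
Proof.
move=> mf mg; apply: (measurableT_comp (f := @Num.sqrt R)).
  by apply: continuous_measurable_fun; exact: sqrt_continuous.
apply: measurable_sum => i; apply: measurable_funX; apply: measurable_funB.
- by have /measurable_fun_tnthP := mf; exact.
- by have /measurable_fun_tnthP := mg; exact.
Qed.

(** The joint law of [f x] and [x], for [x] drawn from [P], is a coupling of cost at most [c]. *)
Lemma W1_image_le p (P : probability (p.-tuple R) R)
    (f : p.-tuple R -> p.-tuple R) (mf : measurable_fun setT f) (c : R) :
  (forall x, dist2 (f x) x <= c) -> (W1 (image_prob P mf) P <= c%:E)%E.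
Proof.
move=> fc.
have mfid : measurable_fun setT (fun x => (f x, x)).
  exact: measurable_fun_pair.
have md : measurable_fun setT
    (fun z : p.-tuple R * p.-tuple R => (dist2 z.1 z.2)%:E).
  by apply/measurable_EFinP; exact: measurable_dist2.
apply: (@le_trans _ _ (\int[image_prob P mfid]_z (dist2 z.1 z.2)%:E)%E).
  apply: ereal_inf_lbound; exists (image_prob P mfid) => //.
  split=> [A mA|B mB].
    transitivity (P (f @^-1` A)); last by [].
    transitivity (P ((fun x => (f x, x)) @^-1` (A `*` setT))); first by [].
    by congr (P _); apply/seteqP; split => x //= -[].
  transitivity (P ((fun x => (f x, x)) @^-1` (setT `*` B))); first by [].
  by congr (P _); apply/seteqP; split => x //= -[].
have d0 (z : p.-tuple R * p.-tuple R) : (0 <= (dist2 z.1 z.2)%:E)%E.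
  by rewrite lee_fin sqrtr_ge0.
rewrite (ge0_integral_image_prob P mfid md d0).
apply: (@le_trans _ _ (\int[P]_x c%:E)%E).
  apply: ge0_le_integral => //=.
  - by move=> x _; exact: (d0 (f x, x)).
  - exact: (measurableT_comp md mfid).
  - by move=> x _; rewrite lee_fin.
rewrite integral_cst//= -[leRHS]mule1.
by rewrite probability_setT.
Qed.

End gaussian_tuple.

(** * Averaging over spike positions *)

Section block_average.
Variables (R : realType) (k m : nat).
Implicit Types (J : {ffun 'I_k -> 'I_m}) (b : 'I_k) (j : 'I_m).

Definition update J b j : {ffun 'I_k -> 'I_m} :=
  [ffun i => if i == b then j else J i].

(* Resampling the coordinate [b] preserves the uniform distribution. *)
Lemma sum_update b (H : {ffun 'I_k -> 'I_m} -> R) :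
  \sum_J \sum_j H (update J b j) = m%:R * \sum_J H J.
Proof.
rewrite pair_big/=.
(* This involution exchanges the new value at [b] with the old one, so that the summand depends on
   the first component only. *)
pose swap (z : {ffun 'I_k -> 'I_m} * 'I_m) := (update z.1 b z.2, z.1 b).
have swapK : cancel swap swap.
  move=> [J j]; rewrite /swap/= ffunE eqxx; congr (_, _).
  by apply/ffunP => i; rewrite !ffunE; case: eqP => // ->.
rewrite (reindex_inj (can_inj swapK))/=.
transitivity (\sum_(z : {ffun 'I_k -> 'I_m} * 'I_m) H z.1).
  apply: eq_bigr => -[J j] _ /=; congr H.
  by apply/ffunP => i; rewrite !ffunE; case: eqP => // ->.
rewrite -(pair_big xpredT xpredT (fun J _ => H J))/= mulr_sumr.
by apply: eq_bigr => J _; rewrite sumr_const card_ord mulr_natl.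
Qed.

(** AM-GM for [D / s] and [s * w], whose product is [D * w]; the bound is linear in [w] and can be
    averaged. *)
Lemma le_mean_of_sqr_le (u D w s : R) : 0 < s -> 0 <= D -> 0 <= w ->
  u ^+ 2 <= D * w -> u <= (D / s + s * w) / 2.
Proof.
move=> s0 D0 w0 uD; set X := D / s.
have DE : D = X * s by rewrite /X divfK ?gt_eqF.
have X0 : 0 <= X by rewrite divr_ge0// ltW.
have sw : 0 <= s * w by rewrite mulr_ge0// ltW.
have [u0|u0] := leP u 0; first by rewrite (le_trans u0)// divr_ge0// addr_ge0.
rewrite -(@ler_pXn2r _ 2) ?nnegrE ?divr_ge0 ?addr_ge0 ?(ltW u0)//.
apply: (le_trans uD); rewrite DE -subr_ge0.
rewrite (_ : _ - _ = ((X - s * w) / 2) ^+ 2) ?sqr_ge0//; by field.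
Qed.

(** [u J] stands for the success probability in block [b], and [w J j] for the probability of
    answering [j] once the spike of that block is removed. As [w J] ignores [J b], resampling that
    coordinate shows that [w J (J b)] averages at most 1/m. *)
Lemma block_average b (u : {ffun 'I_k -> 'I_m} -> R)
    (w : {ffun 'I_k -> 'I_m} -> 'I_m -> R) (D s : R) :
  (0 < m)%N -> 0 < s -> 0 <= D -> (forall J j, 0 <= w J j) ->
  (forall J j i, w (update J b j) i = w J i) ->
  (forall J, \sum_j w J j <= 1) ->
  (forall J, u J ^+ 2 <= D * w J (J b)) ->
  \sum_J u J <= (D / s + s / m%:R) / 2 *+ #|{ffun 'I_k -> 'I_m}|.
Proof.
move=> m0 s0 D0 w0 wupd w1 uD.
have mR : 0 < m%:R :> R by rewrite ltr0n.
have W : \sum_J w J (J b) <= m%:R^-1 *+ #|{ffun 'I_k -> 'I_m}|.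
  rewrite -(ler_pM2l mR) -(sum_update b (fun J => w J (J b))).
  rewrite mulrnAr divff ?gt_eqF// -sumr_const; apply: ler_sum => J _.
  apply: le_trans (w1 J); apply: ler_sum => j _.
  by rewrite wupd ffunE eqxx.
apply: (@le_trans _ _ (\sum_J (D / s + s * w J (J b)) / 2)).
  by apply: ler_sum => J _; exact: le_mean_of_sqr_le.
rewrite -mulr_suml -[leRHS]mulrnAl ler_pM2r ?invr_gt0//.
rewrite big_split/= -[X in _ + X <= _]mulr_sumr mulrnDl -sumr_const lerD2l.
by rewrite -mulrnAr ler_pM2l.
Qed.

Lemma exists_le_mean (T : finType) (x0 : T) (u : T -> R) (a : R) :
  \sum_x u x <= a *+ #|T| -> exists x, u x <= a.
Proof.
move=> ua; apply/not_existsP => H; move: ua; apply/negP; rewrite -ltNge.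
rewrite -sumr_const; apply: ltr_sum => [|x _].
  by apply/hasP; exists x0 => //; rewrite mem_index_enum.
by rewrite ltNge; apply/negP/H.
Qed.

End block_average.

Section occupation.
Local Open Scope ereal_scope.

(* Reverse Markov inequality: if at least [t] of the events [A i] occur outside
   [E], then [E] is likely as soon as the [A i] are unlikely on average. *)
Lemma occupation_le d (T : measurableType d) (R : realType)
    (P : probability T R) (I : finType) (A : I -> set T) (E : set T) (t : R) :
  (0 <= t)%R -> measurable E -> (forall i, measurable (A i)) ->
  (forall x, ~ E x -> (t <= \sum_i \1_(A i) x)%R) ->
  t%:E * (1 - P E) <= \sum_i P (A i).
Proof.
move=> t0 mE mA tE; rewrite -probability_setC//.
have mi (B : set T) : measurable B ->
    measurable_fun setT (fun x => (\1_B x)%:E : \bar R).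
  by move=> mB; apply/measurable_EFinP; exact: measurable_indic.
have mEC := measurableC mE.
have -> : P (~` E) = \int[P]_x (\1_(~` E) x)%:E by rewrite integral_indic// setIT.
rewrite -ge0_integralZl//; last exact: mi.
rewrite (eq_bigr (fun i => \int[P]_x (\1_(A i) x)%:E)); last first.
  by move=> i _; rewrite integral_indic// setIT.
rewrite -ge0_integral_sum//; last by move=> i; exact: mi.
apply: ge0_le_integral => //.
- by move=> x _; rewrite mule_ge0// lee_fin.
- by apply: measurable_funeM; exact: mi.
- by apply: emeasurable_sum => i; exact: mi.
move=> x _; rewrite sumEFin -EFinM lee_fin indicE.
have [xE|xE] := boolP (x \in ~` E); last by rewrite mulr0 sumr_ge0.
by rewrite mulr1; apply: tE; rewrite inE in xE.
Qed.

End occupation.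

(** * Block tests *)

Section spike.
Variables (R : realType) (p : nat).
Implicit Types (a : R) (S : {set 'I_p}) (x y : p.-tuple R).

Definition spike a S : p.-tuple R := [tuple if i \in S then a else 0 | i < p].

Lemma tnth_spike a S i : tnth (spike a S) i = if i \in S then a else 0.
Proof. by rewrite tnth_mktuple. Qed.

Lemma l0norm_spike a S : (l0norm (spike a S) <= #|S|)%N.
Proof.
apply: subset_leq_card; apply/fintype.subsetP => i.
by rewrite inE/= tnth_spike; case: ifP => //; rewrite eqxx.
Qed.

Lemma sum_sqr_spikeU1 a S i0 : i0 \notin S ->
  \sum_i (tnth (spike a (i0 |: S)%SET) i - tnth (spike a S) i) ^+ 2 = a ^+ 2.
Proof.
move=> i0S; rewrite (bigD1 i0)//= big1 ?addr0 => [|i ii0]; rewrite !tnth_spike.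
  by rewrite setU11 (negbTE i0S) subr0.
by rewrite !inE (negbTE ii0)/= subrr expr0n.
Qed.

Lemma le_coord_dist2 x y i : `|tnth x i - tnth y i| <= dist2 x y.
Proof.
rewrite -sqrtr_sqr /dist2 ler_sqrt; last by apply: sumr_ge0 => j _; rewrite sqr_ge0.
by rewrite (bigD1 i)//= lerDl sumr_ge0// => j _; rewrite sqr_ge0.
Qed.

End spike.

Section block_test.
Variables (R : realType) (p k m n : nat) (e : 'I_k * 'I_m -> 'I_p).
Hypothesis e_inj : injective e.
Variables (tau : R) (est : n.-tuple (p.-tuple R) -> p.-tuple R).
Hypothesis mest : measurable_fun setT est.
Implicit Types (J : {ffun 'I_k -> 'I_m}) (b : 'I_k) (j : 'I_m).

Definition spikes J : {set 'I_p} := [set e (b, J b) | b : 'I_k]%SET.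

(** The reference parameter: with block [b0] emptied, its law carries no information on [J b0]. *)
Definition spikes_but J b0 : {set 'I_p} :=
  [set e (b, J b) | b in [set~ b0]]%SET.

(** Asking for exactly one coordinate above the threshold makes these events disjoint in [j]. *)
Definition block_test b j : set (n.-tuple (p.-tuple R)) :=
  [set X | forall i : 'I_m, (tau / 2 < tnth (est X) (e (b, i))) = (i == j)].

Lemma card_spikes J : (#|spikes J| <= k)%N.
Proof. by rewrite (leq_trans (leq_imset_card _ _))// card_ord. Qed.

Lemma mem_spikes J b j : (e (b, j) \in spikes J) = (j == J b).
Proof.
apply/imsetP/eqP => [[b' _ /e_inj[-> ->]]//|->].
by exists b.
Qed.

Lemma spikesE J b : spikes J = (e (b, J b) |: spikes_but J b)%SET.
Proof.
apply/setP => i; apply/imsetP/setU1P => [[b' _ ->]|].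
  have [->|b'b] := eqVneq b' b; first by left.
  by right; apply: imset_f; rewrite !inE.
by case=> [->|/imsetP[b' _ ->]]; [exists b|exists b'].
Qed.

Lemma notin_spikes_but J b j : e (b, j) \notin spikes_but J b.
Proof. by apply/imsetP => -[b' /[!inE] /[swap] /e_inj[<- _] /eqP]. Qed.

Lemma spikes_but_update J b j : spikes_but (update J b j) b = spikes_but J b.
Proof.
by apply: eq_in_imset => b' /[!inE] b'b; rewrite ffunE (negbTE b'b).
Qed.

Lemma measurable_block_test b j : measurable (block_test b j).
Proof.
rewrite (_ : block_test b j = \bigcap_(i in [set: 'I_m])
    ((fun X => tau / 2 < tnth (est X) (e (b, i))) @^-1` [set (i == j)])).
  apply: fin_bigcap_measurable => // i _; rewrite -[X in measurable X]setTI.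
  have mlt : measurable_fun setT (fun X => tau / 2 < tnth (est X) (e (b, i))).
    apply: measurable_fun_ltr => //.
    by have /measurable_fun_tnthP := mest; exact.
  exact: mlt.
by apply/seteqP; split => X /= HX i; [move=> _|]; exact: HX.
Qed.

Lemma sum_block_test (P : probability (n.-tuple (p.-tuple R)) R) b :
  (\sum_j P (block_test b j) <= 1)%E.
Proof.
rewrite -measure_bigsetU_ord//.
- apply: probability_le1; apply: bigsetU_measurable => j _.
  exact: measurable_block_test.
- by move=> j; exact: measurable_block_test.
- apply/trivIsetP => j j' _ _ /eqP jj'; apply/seteqP; split => // X [/= H H'].
  by apply: jj'; apply/eqP; rewrite -H' H.
Qed.

(** A block whose test fails has a coordinate with error at least [tau / 2], and distinct blocks use
    distinct coordinates since [e] is injective. *)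
Lemma sum_sqr_block_test J (X : n.-tuple (p.-tuple R)) : 0 <= tau ->
  tau ^+ 2 / 4 * (k%:R - \sum_b \1_(block_test b (J b)) X) <=
  \sum_i (tnth (spike tau (spikes J)) i - tnth (est X) i) ^+ 2.
Proof.
move=> tau0; set F := fun i => (tnth (spike tau (spikes J)) i - tnth (est X) i) ^+ 2.
have F0 i : 0 <= F i by rewrite sqr_ge0.
apply: (@le_trans _ _ (\sum_(z : 'I_k * 'I_m) F (e z))); last first.
  pose I := [set e z | z : 'I_k * 'I_m]%SET.
  have -> : \sum_z F (e z) = \sum_(i in I) F i.
    by rewrite big_imset => [|z z' _ _ /e_inj//].
  rewrite [leRHS](bigID (fun i => i \in I))/= lerDl.
  by apply: sumr_ge0 => i _; exact: F0.
rewrite (eq_bigr (fun z => F (e (z.1, z.2)))) => [|[]//].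
rewrite -(pair_big xpredT xpredT (fun b j => F (e (b, j))))/=.
have -> : k%:R = \sum_(b < k) (1 : R) by rewrite sumr_const card_ord.
rewrite -sumrB mulr_sumr.
apply: ler_sum => b _; rewrite indicE.
have [_|] := boolP (X \in block_test b (J b)).
  by rewrite subrr mulr0 sumr_ge0.
rewrite subr0 mulr1 => /negP; rewrite inE => /existsNP[j /eqP Hj].
rewrite (bigD1 j)//= -[leLHS]addr0 lerD ?sumr_ge0//.
rewrite /F tnth_spike mem_spikes; move: Hj.
set x := tnth (est X) (e (b, j)).
have -> : tau ^+ 2 / 4 = (tau / 2) ^+ 2 by field.
rewrite -[leRHS]real_normK ?num_real// ler_pXn2r ?nnegrE ?divr_ge0//.
case: (j == J b); have [xt|xt] := ltP (tau / 2) x => //= _.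
- by rewrite ler_normr; apply/orP; left; lra.
- by rewrite ler_normr; apply/orP; right; lra.
Qed.

End block_test.

(** * Lower bound for sparse estimation from the block tests *)

Section sparse_bound.
Variable R : realType.

(* Success rate of guessing which of [m >= 2] coordinates carries a spike of
   height [tau] when [n tau^2 = ln m / 2]: the chi-square argument gives
   [expR (- ln m / 4)], which is largest at [m = 2]. *)
Definition test_rate : R := expR (- (ln 2 / 4)).
Local Notation rho := test_rate.

Lemma test_rate_gt0 : 0 < rho. Proof. exact: expR_gt0. Qed.

Lemma test_rate_lt1 : rho < 1.
Proof. by rewrite expR_lt1 oppr_lt0 divr_gt0// ln_gt0// ltr1n. Qed.

(** Against the law lacking the spike of block [b], the chi-square constant [D] is the square root
    of [m]; [block_average] then gives m^(-1/4). *)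
Lemma block_test_average (p k m n : nat) (e : 'I_k * 'I_m -> 'I_p) (tau : R)
    (est : n.-tuple (p.-tuple R) -> p.-tuple R) (b : 'I_k) :
  injective e -> measurable_fun setT est -> (1 < m)%N ->
  tau ^+ 2 *+ n = ln m%:R / 2 ->
  \sum_(J : {ffun 'I_k -> 'I_m})
    fine (gauss_sample n (spike tau (spikes e J)) (block_test e tau est b (J b)))
  <= rho *+ #|{ffun 'I_k -> 'I_m}|.
Proof.
move=> e_inj mest m1 tauE; pose l : R := ln m%:R.
have m0 : (0 : R) < m%:R by rewrite ltr0n ltnW.
have mE : m%:R = expR l by rewrite lnK.
(* [s = sqrt (m D)] minimizes [D / s + s / m]. *)
pose D := expR (l / 2); pose s := expR (3 / 4 * l).
pose w (J : {ffun 'I_k -> 'I_m}) j :=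
  fine (gauss_sample n (spike tau (spikes_but e J b)) (block_test e tau est b j)).
have mbt j := measurable_block_test e tau mest b j.
apply: (le_trans (block_average (b := b) (w := w) (D := D) (s := s) _ _ _ _ _ _ _)).
- exact: ltnW.
- exact: expR_gt0.
- exact: expR_ge0.
- by move=> J j; rewrite fine_ge0.
- by move=> J j i; rewrite /w spikes_but_update.
- move=> J; rewrite -lee_fin -sumEFin.
  apply: le_trans (sum_block_test e tau mest
    (gauss_sample n (spike tau (spikes_but e J b))) b).
  by apply: lee_sum => j _; rewrite fineK// fin_num_measure.
- move=> J; rewrite (spikesE e J b).
  have := chi2_le_gauss_sample (n := n) (spike tau (e (b, J b) |: spikes_but e J b)%SET)
    (spike tau (spikes_but e J b)).
  rewrite (sum_sqr_spikeU1 _ (notin_spikes_but e_inj J b _)) tauE => H.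
  exact: (chi2_le_fine H (mbt (J b))).
rewrite lerMn2r; apply/orP; right.
have -> : (D / s + s / m%:R) / 2 = expR (- (l / 4)).
  rewrite mE /D /s -!expRN -!expRD.
  rewrite (_ : l / 2 + - (3 / 4 * l) = - (l / 4)); last by field.
  by rewrite (_ : 3 / 4 * l + - l = - (l / 4)); field.
rewrite ler_expR lerN2 ler_pM2r ?invr_gt0//.
by rewrite ler_ln ?posrE ?ltr0n// ?ler_nat// ltnW.
Qed.

(** Averaging gives a [J] for which the expected number of correct blocks is at most [k%:R * rho];
    [occupation_le] then treats every [E] with this same [J]. *)
Lemma sparse_estimation_bound (p k m n : nat) (e : 'I_k * 'I_m -> 'I_p) (tau : R)
    (est : n.-tuple (p.-tuple R) -> p.-tuple R) :
  injective e -> measurable_fun setT est -> (0 < k)%N -> (1 < m)%N -> 0 < tau ->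
  tau ^+ 2 *+ n = ln m%:R / 2 ->
  exists J : {ffun 'I_k -> 'I_m}, let theta := spike tau (spikes e J) in
  forall E : set (n.-tuple (p.-tuple R)), measurable E ->
  (forall X, ~ E X -> dist2 theta (est X) ^+ 2 <=
     tau ^+ 2 / 4 * (k%:R * (1 - rho) / 2)) ->
  (((1 - rho) / 2)%:E <= gauss_sample n theta E)%E.
Proof.
move=> e_inj mest k0 m1 tau0 tauE.
pose u (J : {ffun 'I_k -> 'I_m}) b :=
  fine (gauss_sample n (spike tau (spikes e J)) (block_test e tau est b (J b))).
have mbt b j := measurable_block_test e tau mest b j.
have [J HJ] : exists J, \sum_b u J b <= k%:R * rho.
  apply: (exists_le_mean [ffun=> Ordinal (ltnW m1)]).
  rewrite exchange_big/= -mulrnAr -[k in k%:R]card_ord mulr_natl -sumr_const.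
  by apply: ler_sum => b _; exact: block_test_average.
exists J => theta E mE HE.
have kR : 0 < k%:R :> R by rewrite ltr0n.
have rho0 := test_rate_gt0; have rho1 := test_rate_lt1.
(* The threshold lies midway between [k%:R * rho] and [k%:R]: outside [E], the small loss allows at
   most [k%:R * (1 - rho) / 2] failed blocks. *)
have t0 : 0 <= k%:R * (1 + rho) / 2 by rewrite divr_ge0// mulr_ge0// addr_ge0// ltW.
have := occupation_le (gauss_sample n theta) t0 mE (fun b => mbt b (J b)).
have fE : gauss_sample n theta E \is a fin_num by rewrite fin_num_measure.
have -> : (\sum_b gauss_sample n theta (block_test e tau est b (J b)) =
    (\sum_b u J b)%:E)%E.
  by rewrite -sumEFin; apply: eq_bigr => b _; rewrite /u fineK// fin_num_measure.
rewrite -(fineK fE); set y := fine _.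
have y0 : 0 <= y by rewrite /y fine_ge0.
rewrite -EFinB -EFinM !lee_fin => H.
have {}H : k%:R * (1 + rho) / 2 * (1 - y) <= k%:R * rho.
  apply: le_trans HJ; apply: H => X /HE {}HE.
  have := sum_sqr_block_test e_inj est J X (ltW tau0).
  rewrite -[leRHS]sqr_sqrtr; last by apply: sumr_ge0 => i _; exact: sqr_ge0.
  move=> /le_trans /(_ HE); rewrite ler_pM2l ?divr_gt0 ?exprn_gt0//; lra.
have : (1 + rho) * (1 - y) <= 2 * rho.
  by rewrite -(ler_pM2l kR); lra.
(* Hence [y] is at least [(1 - rho) / (1 + rho)], which exceeds [(1 - rho) / 2] because
   [rho < 1]. *)
nra.
Qed.

End sparse_bound.

(** * The lower bound *)

Section assembly.
Variable R : realType.
Local Notation rho := (test_rate R).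

Lemma block_embedding (k m p : nat) : (k * m <= p)%N ->
  exists e : 'I_k * 'I_m -> 'I_p, injective e.
Proof.
move=> kmp.
have lt_p (z : 'I_k * 'I_m) : (z.1 * m + z.2 < p)%N.
  apply: leq_trans kmp; apply: (@leq_trans (z.1.+1 * m)); last by rewrite leq_mul2r ltn_ord orbT.
  by rewrite mulSnr ltn_add2l.
(* Euclidean division by [m] recovers the block and the position. *)
exists (fun z => Ordinal (lt_p z)) => -[b j] [b' j'] /(congr1 val)/= E.
have m0 : (0 < m)%N by exact: leq_ltn_trans (ltn_ord j).
congr (_, _); apply: val_inj.
  by have := congr1 (divn^~ m) E; rewrite !divnMDl// !divn_small// !addn0.
by have := congr1 (modn^~ m) E; rewrite !modnMDl !modn_small.
Qed.

(** With m = [p %/ k] at least 2, p / k < m + 1 <= 2 m <= m^2. *)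
Lemma ln_ratio_le (p k : nat) : (0 < k)%N -> (k.*2 < p)%N ->
  ln (p%:R / k%:R) <= 2 * ln (p %/ k)%:R :> R.
Proof.
move=> k0 kp; set m := (p %/ k)%N.
have m2 : (1 < m)%N by rewrite leq_divRL// mul2n ltnW.
have kR : (0 : R) < k%:R by rewrite ltr0n.
have mR : (0 : R) < m%:R by rewrite ltr0n ltnW.
have pR : (0 : R) < p%:R by rewrite ltr0n (leq_ltn_trans _ kp).
rewrite -[leRHS]/(2%:R * _) [leRHS]mulr_natl -lnXn// ler_ln ?posrE ?divr_gt0 ?exprn_gt0//.
rewrite ler_pdivrMr// -natrX -natrM ler_nat.
have /ltnW pm : (p < m.+1 * k)%N by rewrite -ltn_divLR.
apply: (leq_trans pm); rewrite leq_mul2r; apply/orP; right.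
rewrite -mulnn; apply: leq_trans (leq_mul m2 (leqnn m)).
by rewrite mul2n -addnn -addn1 leq_add2l ltnW.
Qed.

Lemma measurable_dist2_ge (p n : nat) (theta : p.-tuple R)
    (est : n.-tuple (p.-tuple R) -> p.-tuple R) (t : R) :
  measurable_fun setT est ->
  measurable [set X | t <= dist2 theta (est X)].
Proof.
move=> mest; rewrite -[X in measurable X]setTI.
have : measurable_fun setT (fun X => t <= dist2 theta (est X)).
  by apply: measurable_fun_ler => //; exact: measurable_dist2.
by move=> /(_ measurableT [set true]); apply.
Qed.

(** The Gaussian law at [theta] is realized as a translate of the one at [theta'], which makes the
    coupling explicit. *)
Lemma gauss_W1P (p : nat) (theta theta' : p.-tuple R) :
  exists G : probability (p.-tuple R) R,
    is_std_gaussian theta G /\ (W1 G (gauss theta') <= (dist2 theta theta')%:E)%E.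
Proof.
pose v : p.-tuple R := [tuple tnth theta i - tnth theta' i | i < p].
exists (image_prob (gauss theta') (measurable_shift_tuple v)); split.
  apply: gauss_shiftP; apply: eq_from_tnth => i.
  by rewrite !tnth_mktuple addrC subrK.
apply: W1_image_le => x; rewrite le_eqVlt; apply/orP; left; apply/eqP; congr Num.sqrt.
by apply: eq_bigr => i _; rewrite !tnth_mktuple addrAC subrr add0r.
Qed.

(** One data law serves both candidate parameters. Their two error events cover the sample space, so
    one of them has probability at least 1/2. *)
Lemma two_point_bound (p n : nat) (eps C : R) (i0 : 'I_p)
    (est : n.-tuple (p.-tuple R) -> p.-tuple R) :
  0 <= eps -> C <= 1 / 2 -> measurable_fun setT est ->
  let theta0 : p.-tuple R := spike 0 finset.set0 in
  exists2 theta : p.-tuple R, (l0norm theta <= 1)%N &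
    dist2 theta theta0 <= eps /\
    ((1 / 2)%:E <= gauss_sample n theta0
       [set X | (C * eps <= dist2 theta (est X))%R])%E.
Proof.
move=> eps0 C2 mest theta0; pose theta1 : p.-tuple R := spike eps [set i0]%SET.
pose E theta : set (n.-tuple (p.-tuple R)) :=
  [set X | (C * eps <= dist2 theta (est X))%R].
have mE theta : measurable (E theta) by exact: measurable_dist2_ge.
have cover : E theta0 `|` E theta1 = setT.
  apply/seteqP; split => // X _; rewrite /E/=.
  set x := tnth (est X) i0.
  (* Coordinate [i0] is 0 for [theta0] and [eps] for [theta1], so the estimate is at least [eps / 2]
     away from one of them. *)
  have [xe|xe] := leP (eps / 2) `|x|; [left|right].
    apply: (le_trans _ (le_coord_dist2 _ _ i0)); rewrite -/x tnth_spike inE.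
    by rewrite sub0r normrN; nra.
  apply: (le_trans _ (le_coord_dist2 _ _ i0)); rewrite -/x tnth_spike set11.
  by rewrite ler_normr; apply/orP; left; move: xe; rewrite ltr_norml => /andP[? ?]; nra.
have [H|H] := leP (1 / 2)%:E (gauss_sample n theta0 (E theta0)).
  exists theta0; first by rewrite (leq_trans (l0norm_spike _ _))// cards0.
  by split => //; rewrite /dist2 big1 ?sqrtr0// => i _; rewrite subrr expr0n.
exists theta1; first by rewrite (leq_trans (l0norm_spike _ _))// cards1.
split.
  rewrite -[leRHS](ger0_norm eps0) -sqrtr_sqr /dist2.
  rewrite -(sum_sqr_spikeU1 eps (i0 := i0) (S := finset.set0)) ?inE//.
  rewrite le_eqVlt; apply/orP; left; apply/eqP; congr Num.sqrt.
  by apply: eq_bigr => i _; rewrite !tnth_spike !inE orbF.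
rewrite leNgt; apply/negP => H'.
have : (1 <= gauss_sample n theta0 (E theta0) + gauss_sample n theta0 (E theta1))%E.
  by rewrite -(probability_setT (gauss_sample n theta0)) -cover; exact: measureU2.
apply/negP; rewrite -ltNge.
apply: (lt_le_trans (lteD H H')); rewrite -EFinD lee_fin; lra.
Qed.

End assembly.

Theorem theorem7 (R : realType) :
  exists C c : R, 0 < C /\ 0 < c /\
  forall (p k n : nat) (eps : R),
    (0 < k)%N -> (k.*2 < p)%N -> (0 < n)%N -> 0 <= eps ->
    forall est : n.-tuple (p.-tuple R) -> p.-tuple R,
      measurable_fun setT est ->
      (c%:E <= ereal_sup
        [set r : \bar R | exists (theta : p.-tuple R)
                                 (Q : probability (n.-tuple (p.-tuple R)) R),
           (l0norm theta <= k)%N /\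
           (exists (P : probability (p.-tuple R) R)
                   (G : probability (p.-tuple R) R),
              is_std_gaussian theta G /\ (W1 G P <= eps%:E)%E /\
              is_iid_sample_law P Q) /\
           r = Q [set X | (C * Num.max
                   (Num.sqrt (k%:R * ln (p%:R / k%:R) / n%:R)) eps
                   <= dist2 theta (est X))%R]])%E.
Proof.
set rho := test_rate R.
have rho0 : 0 < rho := test_rate_gt0 R; have rho1 : rho < 1 := test_rate_lt1 R.
have C20 : 0 < (1 - rho) / 32 by lra.
(* Chosen so that C^2 (2 k ln m / n) equals the loss (tau^2 / 4) k (1 - rho) / 2 of the sparse bound
   when tau^2 = ln m / (2 n). *)
pose C := Num.sqrt ((1 - rho) / 32).
have C0 : 0 < C by rewrite sqrtr_gt0.
have CC : C ^+ 2 = (1 - rho) / 32 by rewrite sqr_sqrtr// ltW.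
exists C, ((1 - rho) / 2); split => //; split; first by lra.
move=> p k n eps k0 kp n0 eps0 est mest.
set r := Num.sqrt (_ / n%:R).
have [re|er] := leP r eps.
  have i0 : 'I_p := Ordinal (leq_ltn_trans (leq0n _) kp).
  have C2 : C <= 1 / 2 by nra.
  have [theta l0 [dtheta HQ]] := two_point_bound i0 eps0 C2 mest.
  (* The data follow the Gaussian law at 0, within [eps] of the Gaussian law at [theta]. *)
  have [G [HG W]] := gauss_W1P theta (spike 0 finset.set0).
  apply: le_trans (ereal_sup_ubound _); last first.
    exists theta, (gauss_sample n (spike 0 finset.set0)).
    split; first exact: leq_trans l0 k0.
    split; last by [].
    exists (gauss (spike 0 finset.set0)), G; split => //; split.
      by apply: (le_trans W); rewrite lee_fin.
    exact: gauss_sampleP.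
  by apply: le_trans HQ; rewrite lee_fin; lra.
(* The sparse regime; [k.*2 < p] gives every block at least two positions. *)
pose m := (p %/ k)%N.
have m2 : (1 < m)%N by rewrite leq_divRL// mul2n ltnW.
have [e e_inj] : exists e : 'I_k * 'I_m -> 'I_p, injective e.
  by apply: block_embedding; rewrite mulnC leq_divM.
have lm0 : 0 < ln m%:R :> R by rewrite ln_gt0// ltr1n.
have nR : 0 < n%:R :> R by rewrite ltr0n.
have kR : 0 < k%:R :> R by rewrite ltr0n.
pose tau : R := Num.sqrt (ln m%:R / (2 * n%:R)).
have tau0 : 0 < tau by rewrite sqrtr_gt0 divr_gt0// mulr_gt0.
have tau2 : tau ^+ 2 = ln m%:R / (2 * n%:R).
  by rewrite sqr_sqrtr// divr_ge0 ?ltW// mulr_gt0.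
have tauE : tau ^+ 2 *+ n = ln m%:R / 2.
  by rewrite tau2 -[LHS]mulr_natr; field; rewrite gt_eqF.
have [J HJ] := sparse_estimation_bound e_inj mest k0 m2 tau0 tauE.
set theta := spike tau (spikes e J) in HJ.
(* The data follow the model itself: [G] is its translate by the zero vector. *)
have [G [HG W]] := gauss_W1P theta theta.
apply: le_trans (ereal_sup_ubound _); last first.
  exists theta, (gauss_sample n theta).
  split; first exact: (leq_trans (l0norm_spike _ _) (card_spikes _ _)).
  split; last by [].
  exists (gauss theta), G; split => //; split; last exact: gauss_sampleP.
  apply: (le_trans W); rewrite lee_fin /dist2 big1 ?sqrtr0// => i _.
  by rewrite subrr expr0n.
apply: HJ; first exact: measurable_dist2_ge.
move=> X /negP; rewrite -ltNge => /ltW dX.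
have rE : r ^+ 2 <= 2 * k%:R * ln m%:R / n%:R.
  rewrite sqr_sqrtr; last first.
    rewrite divr_ge0 ?mulr_ge0 ?ln_ge0 ?ltW// ?ltr_pdivlMr// mul1r ltr_nat.
    by rewrite (leq_ltn_trans _ kp)// -addnn leq_addr.
  by rewrite ler_pM2r ?invr_gt0// (mulrC 2) -mulrA ler_pM2l// ln_ratio_le.
apply: (@le_trans _ _ ((C * r) ^+ 2)).
  by rewrite ler_pXn2r ?nnegrE ?sqrtr_ge0// mulr_ge0 ?sqrtr_ge0.
rewrite exprMn CC; apply: (le_trans (ler_wpM2l (ltW C20) rE)).
rewrite -/rho tau2 le_eqVlt; apply/orP; left; apply/eqP; field.
by rewrite gt_eqF.
Qed.
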